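(* For every $n\in\mathbb{N}$ there exists a constant $C=C(n)>0$ such that for every $d>n$ and every $S\subset\mathbb{R}^d$, $$\alpha(x,r)^2\le C\,\mathsf{a}(x,r)\qquad\text{for every }x\in S,\ r>0.$$
   Context: $\mathbb{N}=\{1,2,\dots\}$. $B_r(x)$ denotes the open Euclidean ball in $\mathbb{R}^d$, and $B^{\mathbb{R}^n}_r(0)$ the open Euclidean ball in $\mathbb{R}^n$. $\mathsf{d}_H$ is the Hausdorff distance between subsets of $\mathbb{R}^d$ and $\mathsf{d}_{GH}$ is the Gromov-Hausdorff distance between metric spaces. For $S\subset\mathbb{R}^d$, $n<d$, $x\in S$ and $r>0$ set $$\alpha(x,r):=r^{-1}\inf_{\Gamma}\mathsf{d}_H(S\cap B_r(x),\Gamma\cap B_r(x)),$$ where the infimum is over all $n$-dimensional affine planes $\Gamma\subset\mathbb{R}^d$ containing $x$, and $$\mathsf{a}(x,r):=r^{-1}\mathsf{d}_{GH}\big(B^{(S,\mathsf{d}_{Eucl})}_r(x),B^{\mathbb{R}^n}_r(0)\big),$$ where $B^{(S,\mathsf{d}_{Eucl})}_r(x)=S\cap B_r(x)$ is the ball in $S$ endowed with the restriction of the Euclidean distance, regarded as a metric space, and $B^{\mathbb{R}^n}_r(0)$ carries the Euclidean distance. *)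

(* Defs.v *)
From HB Require Import structures.
From mathcomp Require Import all_boot all_order all_algebra.
From mathcomp Require Import all_classical all_reals all_analysis.
From mathcomp Require Import ring lra.

Set Implicit Arguments.
Unset Strict Implicit.
Unset Printing Implicit Defensive.

Import Order.TTheory GRing.Theory Num.Theory.
Import numFieldNormedType.Exports.

Local Open Scope classical_set_scope.
Local Open Scope ring_scope.

(* An alias of 'rV[R]_d, whose own norm and topology are those of the sup norm:
   only the vector space structure is copied here, and balls and distances on
   [euclidean R d] come from the Euclidean metric installed below. *)
Definition euclidean (R : realType) (d : nat) : Type := 'rV[R]_d.

HB.instance Definition _ (R : realType) (d : nat) :=
  Vector.copy (euclidean R d) 'rV[R]_d.

Definition euclidean_dist (R : realType) (d : nat) (x y : euclidean R d) : R :=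
  Num.sqrt (\sum_(i < d) (x ord0 i - y ord0 i) ^+ 2).

Section euclidean_metric.
Variables (R : realType) (d : nat).
Implicit Types (x y z : euclidean R d) (a b : 'I_d -> R).

Let sqr_sum_ge0 a : 0 <= \sum_i a i ^+ 2.
Proof. by apply: sumr_ge0 => i _; exact: sqr_ge0. Qed.

Let cauchy_schwarz a b :
  (\sum_i a i * b i) ^+ 2 <= (\sum_i a i ^+ 2) * (\sum_i b i ^+ 2).
Proof.
set P := \sum_i _ * _; set A := \sum_i a i ^+ 2; set B := \sum_i b i ^+ 2.
have H : 0 <= B * (A * B - P ^+ 2).
  have : 0 <= \sum_i (B * a i - P * b i) ^+ 2 by exact: sqr_sum_ge0.
  suff -> : \sum_i (B * a i - P * b i) ^+ 2 = B * (A * B - P ^+ 2) by [].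
  transitivity (B ^+ 2 * A - 2 * B * P * P + P ^+ 2 * B); last by ring.
  transitivity (\sum_i (B ^+ 2 * a i ^+ 2 - 2 * B * P * (a i * b i)
                        + P ^+ 2 * b i ^+ 2)).
    by apply: eq_bigr => i _; ring.
  by rewrite big_split sumrB -!mulr_sumr.
have [B0|B0] := eqVneq B 0.
  suff -> : P = 0 by rewrite B0 mulr0 expr0n.
  have b0 i : b i = 0.
    have /psumr_eq0P : B = 0 by [].
    move=> /(_ (fun i _ => sqr_ge0 (b i))) /(_ i isT) /eqP.
    by rewrite sqrf_eq0 => /eqP.
  by rewrite /P big1 // => i _; rewrite b0 mulr0.
have Bgt0 : 0 < B by rewrite lt_neqAle eq_sym B0 sqr_sum_ge0.
by move: H; rewrite pmulr_rge0 // subr_ge0.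
Qed.

Lemma euclidean_distxx x : euclidean_dist x x = 0.
Proof.
by rewrite /euclidean_dist big1 ?sqrtr0 // => i _; rewrite subrr expr0n.
Qed.

Lemma euclidean_dist_positivity x y : euclidean_dist x y = 0 -> x = y.
Proof.
move=> /eqP; rewrite sqrtr_eq0 => le0.
have /psumr_eq0P : \sum_i (x ord0 i - y ord0 i) ^+ 2 = 0.
  by apply/eqP; rewrite eq_le le0 /= sumr_ge0 // => i _; exact: sqr_ge0.
move=> /(_ (fun i _ => sqr_ge0 _)) e0.
apply/rowP => i; apply/eqP; rewrite -subr_eq0 -sqrf_eq0.
by apply/eqP; exact: e0.
Qed.

Lemma euclidean_dist_sym x y : euclidean_dist x y = euclidean_dist y x.
Proof.
by congr Num.sqrt; apply: eq_bigr => i _; rewrite -sqrrN opprB.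
Qed.

Lemma euclidean_dist_triangle y x z :
  euclidean_dist x z <= euclidean_dist x y + euclidean_dist y z.
Proof.
have d0 (u v : euclidean R d) : 0 <= euclidean_dist u v by exact: sqrtr_ge0.
have dd (u v : euclidean R d) : euclidean_dist u v ^+ 2 = \sum_i (u ord0 i - v ord0 i) ^+ 2.
  by rewrite sqr_sqrtr //; apply: sumr_ge0 => i _; exact: sqr_ge0.
rewrite -(@ler_pXn2r _ 2) ?nnegrE ?addr_ge0 ?d0 //.
rewrite sqrrD !dd.
pose a i := x ord0 i - y ord0 i; pose b i := y ord0 i - z ord0 i.
have -> : \sum_i (x ord0 i - z ord0 i) ^+ 2 =
    \sum_i a i ^+ 2 + (\sum_i a i * b i) *+ 2 + \sum_i b i ^+ 2.
  rewrite -sumrMnl -!big_split /=; apply: eq_bigr => i _; rewrite /a /b; ring.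
rewrite lerD2r lerD2l lerMn2r /= (le_trans (ler_norm _)) //.
rewrite -(@ler_pXn2r _ 2) ?nnegrE ?mulr_ge0 ?d0 //.
by rewrite real_normK ?num_real // exprMn !dd; exact: (cauchy_schwarz a b).
Qed.

HB.instance Definition _ := @isMetric.Build R (euclidean R d)
  (@euclidean_dist R d) euclidean_distxx euclidean_dist_positivity
  euclidean_dist_sym euclidean_dist_triangle.

End euclidean_metric.

Section subset_metric.
Variables (R : realType) (X : metricType R) (A : set X).

Let sub_dist (x y : A) : R := mdist (set_val x) (set_val y).

Let sub_dist_ge0 x y : 0 <= sub_dist x y.
Proof. exact: mdist_ge0. Qed.

Let sub_dist_positivity x y : sub_dist x y = 0 -> x = y.
Proof. by move=> /mdist_positivity; exact: val_inj. Qed.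

Let sub_ballE x e : ball x e = [set y | sub_dist x y < e].
Proof. by rewrite -initial_ballE ballEmdist. Qed.

HB.instance Definition _ := PseudoMetric_isMetric.Build R (A : Type)
  sub_dist_ge0 sub_dist_positivity sub_ballE.

End subset_metric.

(* Distances and infima of distances are extended reals, so that an infimum over
   an empty family is +oo rather than a default value. *)
Definition hausdorff_dist (R : realType) (X : metricType R) (A B : set X) :
    \bar R :=
  ereal_inf [set e%:E | e in [set e : R | 0 < e /\
    A `<=` \bigcup_(b in B) ball b e /\ B `<=` \bigcup_(a in A) ball a e]].

Definition isometric (R : realType) (X Y : metricType R) (f : X -> Y) : Prop :=
  forall x y, mdist (f x) (f y) = mdist x y.

Definition gromov_hausdorff_dist (R : realType) (X Y : metricType R) : \bar R :=
  ereal_inf [set e | exists (Z : metricType R) (f : X -> Z) (g : Y -> Z),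
    [/\ isometric f, isometric g & e = hausdorff_dist (range f) (range g)]].

Definition affine_plane (R : realType) (d n : nat) (G : set (euclidean R d)) :
    Prop :=
  exists (p : euclidean R d) (V : {vspace euclidean R d}),
    \dim V = n /\ G = [set p + v | v in [set` V]].

Definition alpha (R : realType) (d n : nat) (S : set (euclidean R d))
    (x : euclidean R d) (r : R) : \bar R :=
  ((r^-1)%:E * ereal_inf [set hausdorff_dist (S `&` ball x r) (G `&` ball x r)
    | G in [set G : set (euclidean R d) | affine_plane n G /\ G x]])%E.

(* The rescaled Gromov-Hausdorff distance written a(x, r) in the source; each
   [set_type] carries the restriction of the Euclidean distance. *)
Definition GH_flatness (R : realType) (d n : nat) (S : set (euclidean R d))
    (x : euclidean R d) (r : R) : \bar R :=
  ((r^-1)%:E * gromov_hausdorff_dist (set_type (S `&` ball x r))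
    (set_type (ball (0%R : euclidean R n) r)))%E.

(* Main.v *)
(* If the Gromov-Hausdorff distance is below e, there is a correspondence
   between A = S `&` ball x r and the model ball distorting distances by at most
   2e. It pairs x with a point within 2e of the origin, so by polarization it
   also preserves inner products of vectors based at x, up to O(e r). Hence the
   partners of the points (r / 2) e_i, rescaled, form a nearly orthonormal frame
   w, and for s paired with y, expanding the square,
     |s - x - sum_i y_i w_i|^2 = |y|^2 - 2 |y|^2 + |y|^2 + O(n e r) = O(n e r).
   So A lies within O(sqrt (n e r)) of the plane through x spanned by w, and vice
   versa; the square root is the source of the exponent 2. When e is not small
   compared with r, the trivial bound alpha <= 1 suffices. *)
Require Import Defs.
From mathcomp Require Import all_boot all_order all_algebra.
From mathcomp Require Import all_classical all_reals all_analysis.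
From mathcomp Require Import ring lra.

Import Order.TTheory GRing.Theory Num.Theory.
Import numFieldNormedType.Exports.

Local Open Scope classical_set_scope.
Local Open Scope ring_scope.

(** * Euclidean inner product and norm on [euclidean R d] *)

Definition dot {R : realType} {d : nat} (u v : euclidean R d) : R :=
  \sum_(i < d) u ord0 i * v ord0 i.

Definition enorm {R : realType} {d : nat} (u : euclidean R d) : R :=
  Num.sqrt (dot u u).

Section dot_product.
Context {R : realType} {d : nat}.
Implicit Types u v w : euclidean R d.

Lemma dotC u v : dot u v = dot v u.
Proof. by apply: eq_bigr => i _; rewrite mulrC. Qed.

Lemma dotDl u v w : dot (u + v) w = dot u w + dot v w.
Proof. by rewrite -big_split; apply: eq_bigr => i _; rewrite mxE mulrDl. Qed.

Lemma dotZl a u v : dot (a *: u) v = a * dot u v.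
Proof. by rewrite mulr_sumr; apply: eq_bigr => i _; rewrite mxE mulrA. Qed.

Lemma dotNl u v : dot (- u) v = - dot u v.
Proof. by rewrite -scaleN1r dotZl mulN1r. Qed.

Lemma dotBl u v w : dot (u - v) w = dot u w - dot v w.
Proof. by rewrite dotDl dotNl. Qed.

Lemma dotBr u v w : dot u (v - w) = dot u v - dot u w.
Proof. by rewrite dotC dotBl !(dotC u). Qed.

Lemma dotZr a u v : dot u (a *: v) = a * dot u v.
Proof. by rewrite dotC dotZl dotC. Qed.

Lemma dot0l u : dot 0 u = 0.
Proof. by rewrite -(scale0r (0 : euclidean R d)) dotZl mul0r. Qed.

Lemma dot_suml (I : finType) (F : I -> euclidean R d) v :
  dot (\sum_i F i) v = \sum_i dot (F i) v.
Proof.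
by apply: (big_morph (fun u => dot u v)) => [u w|]; rewrite ?dotDl ?dot0l.
Qed.

Lemma dot_sumr (I : finType) (F : I -> euclidean R d) v :
  dot v (\sum_i F i) = \sum_i dot v (F i).
Proof. by rewrite dotC dot_suml; apply: eq_bigr => i _; rewrite dotC. Qed.

Lemma dot_ge0 u : 0 <= dot u u.
Proof. by apply: sumr_ge0 => i _; rewrite -expr2 sqr_ge0. Qed.

Lemma sqr_enorm u : enorm u ^+ 2 = dot u u.
Proof. by rewrite sqr_sqrtr // dot_ge0. Qed.

Lemma enorm_ge0 u : 0 <= enorm u.
Proof. exact: sqrtr_ge0. Qed.

Lemma enormZ a u : enorm (a *: u) = `|a| * enorm u.
Proof.
by rewrite /enorm dotZl dotZr mulrA -expr2 sqrtrM ?sqr_ge0 // sqrtr_sqr.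
Qed.

Lemma enormN u : enorm (- u) = enorm u.
Proof. by rewrite -scaleN1r enormZ normrN1 mul1r. Qed.

Lemma mdist_enorm u v : mdist u v = enorm (u - v).
Proof.
rewrite /mdist /= /euclidean_dist /enorm; congr Num.sqrt.
by apply: eq_bigr => i _; rewrite !mxE expr2.
Qed.

Lemma ler_enormD u v : enorm (u + v) <= enorm u + enorm v.
Proof.
have := metric_triangle u (0 : euclidean R d) (- v).
by rewrite !mdist_enorm sub0r !opprK subr0.
Qed.

Lemma ball_enorm u (r : R) : ball u r = [set v | enorm (u - v) < r].
Proof. by rewrite ballEmdist; apply/seteqP; split => v /=; rewrite mdist_enorm. Qed.

Lemma coord_le_enorm u i : `|u ord0 i| <= enorm u.
Proof.
rewrite -sqrtr_sqr ler_wsqrtr // /dot (bigD1 i) //= expr2 lerDl.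
by apply: sumr_ge0 => j _; rewrite -expr2 sqr_ge0.
Qed.

Lemma dot_delta u (i : 'I_d) : dot u (delta_mx ord0 i : 'rV[R]_d) = u ord0 i.
Proof.
rewrite /dot (bigD1 i) //= mxE !eqxx mulr1 big1 ?addr0 // => j /negPf ji.
by rewrite mxE ji andbF mulr0.
Qed.

End dot_product.

(** * Linear combinations of a nearly orthonormal frame *)

Definition lincomb {R : realType} {d n : nat} (w : 'I_n -> euclidean R d)
  (c : euclidean R n) : euclidean R d := \sum_i c ord0 i *: w i.

Section near_orthonormal_frame.
Context {R : realType} {d n : nat} (w : 'I_n -> euclidean R d).

Lemma lincombZ a c : lincomb w (a *: c) = a *: lincomb w c.
Proof.
by rewrite scaler_sumr; apply: eq_bigr => i _; rewrite mxE scalerA.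
Qed.

(** Each of the n coordinates contributes at most |y| [delta]. This controls the cross term when |s
    - x - sum_i y_i w_i|^2 is expanded. *)
Lemma dot_lincomb_near (s : euclidean R d) (y : euclidean R n) (delta : R) :
  (forall i, `|dot s (w i) - y ord0 i| <= delta) ->
  `|dot s (lincomb w y) - dot y y| <= delta * (n%:R * enorm y).
Proof.
move=> sw; rewrite dot_sumr -sumrB (le_trans (ler_norm_sum _ _ _)) //.
have -> : delta * (n%:R * enorm y) = \sum_(i < n) (enorm y * delta).
  by rewrite sumr_const card_ord -mulr_natl; ring.
apply: ler_sum => i _; rewrite dotZr -mulrBr normrM.
by rewrite ler_pM // coord_le_enorm.
Qed.

(** Both sides are double sums over (i, j), compared entry by entry through |c_i c_j| <= (c_i^2 +
    c_j^2) / 2; summing the right side over i and j gives n |c|^2. *)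
Lemma sqr_enorm_lincomb_near (c : euclidean R n) (delta : R) :
  (forall i j, `|dot (w i) (w j) - (i == j)%:R| <= delta) ->
  `|dot (lincomb w c) (lincomb w c) - dot c c| <= delta * n%:R * dot c c.
Proof.
move=> ww.
have -> : delta * n%:R * dot c c =
    \sum_(i < n) \sum_(j < n) (c ord0 i ^+ 2 / 2 + c ord0 j ^+ 2 / 2) * delta.
  have -> : dot c c = \sum_(i < n) c ord0 i ^+ 2.
    by apply: eq_bigr => i _; rewrite expr2.
  transitivity (\sum_(i < n) (c ord0 i ^+ 2 / 2 * n%:R +
      (\sum_(j < n) c ord0 j ^+ 2) / 2) * delta); last first.
    apply: eq_bigr => i _; rewrite -mulr_suml big_split /= sumr_const card_ord.
    by rewrite mulr_natr mulr_suml.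
  rewrite -mulr_suml big_split /= sumr_const card_ord -2!mulr_suml -mulr_natr.
  by field.
have -> : dot c c = \sum_i \sum_j c ord0 i * c ord0 j * (i == j)%:R.
  apply: eq_bigr => i _; rewrite (bigD1 i) //= eqxx mulr1 big1 ?addr0 //.
  by move=> j /negPf ji; rewrite eq_sym ji mulr0.
have -> : dot (lincomb w c) (lincomb w c) =
    \sum_i \sum_j c ord0 i * c ord0 j * dot (w i) (w j).
  rewrite dot_suml; apply: eq_bigr => i _; rewrite dot_sumr.
  by apply: eq_bigr => j _; rewrite dotZl dotZr mulrA.
rewrite -sumrB (le_trans (ler_norm_sum _ _ _)) //.
apply: ler_sum => i _; rewrite -sumrB (le_trans (ler_norm_sum _ _ _)) //.
apply: ler_sum => j _; rewrite -mulrBr normrM ler_pM // normrM.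
rewrite -(real_normK (num_real (c ord0 i))) -(real_normK (num_real (c ord0 j))).
have := sqr_ge0 (`|c ord0 i| - `|c ord0 j|).
by rewrite -subr_ge0 => H; nra.
Qed.

End near_orthonormal_frame.

(** * From an almost isometric correspondence to an approximating plane *)

Lemma dot_polarization (R : realType) (d : nat) (u v : euclidean R d) :
  2 * dot u v = dot u u + dot v v - dot (u - v) (u - v).
Proof. by rewrite dotBl !dotBr (dotC v u); ring. Qed.

Lemma ler_dist_sqr (R : realType) (m t a b : R) :
  0 <= a <= m -> 0 <= b <= m -> `|a - b| <= t -> `|a ^+ 2 - b ^+ 2| <= 2 * m * t.
Proof.
move=> /andP[a0 am] /andP[b0 bm] abt.
rewrite subr_sqr normrM mulrC (ger0_norm (addr_ge0 a0 b0)).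
by rewrite ler_pM ?addr_ge0 // mulr_natl mulr2n lerD.
Qed.

Section near_isometry.
Context {R : realType} {d n : nat} {A : set (euclidean R d)}.
Context {x : euclidean R d} {r e : R}.
Context {rel : euclidean R d -> euclidean R n -> Prop}.
Context (e_gt0 : 0 < e) (r_gt0 : 0 < r) (A_x : A x) (A_ball : A `<=` ball x r).
Context (rel_A : forall s, A s -> exists y, rel s y).
Context (rel_ball : forall y, enorm y < r -> exists s, rel s y).
Context (relP : forall s y, rel s y -> A s /\ enorm y < r).
Context (rel_dist : forall s y s' y', rel s y -> rel s' y' ->
  `|enorm (s - s') - enorm (y - y')| <= 2 * e).

Let A_norm s : A s -> enorm (s - x) < r.
Proof. by move=> /A_ball; rewrite ball_enorm /= -opprB enormN. Qed.

(* The point of the model ball lying opposite to y is at distance almost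
   r + |y| from y, whereas every point of A is within r of x. *)
Lemma rel_center_small y : rel x y -> enorm y <= 2 * e.
Proof.
move=> xy; have [y0|y0] := eqVneq (enorm y) 0; first by have := e_gt0; rewrite y0; lra.
have ygt0 : 0 < enorm y by rewrite lt_neqAle eq_sym y0 enorm_ge0.
apply/ler_addgt0Pr => t t0.
(* The model ball is open, so the opposite point has norm q < r, with q >= r - t for the arbitrarily
   small t. *)
pose q := Num.max 0 (r - t); have q0 : 0 <= q by rewrite le_max lexx.
have qr : q < r by rewrite gt_max r_gt0 ltrBlDr ltrDl.
have [s] : exists s, rel s (- (q / enorm y) *: y).
  apply: rel_ball; rewrite enormZ normrN ger0_norm ?divr_ge0 ?enorm_ge0 //.
  by rewrite divfK.
move=> sy; have [/A_norm sx _] := relP _ _ sy.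
have := rel_dist _ _ _ _ sy xy.
have -> : - (q / enorm y) *: y - y = - (q / enorm y + 1) *: y.
  by rewrite opprD scalerDl scaleN1r.
have q1 : 0 <= q / enorm y + 1 by rewrite addr_ge0 // divr_ge0 // enorm_ge0.
rewrite enormZ normrN (ger0_norm q1).
rewrite mulrDl divfK // mul1r ler_distl => /andP[H _].
have : r - t <= q by rewrite le_max lexx orbT.
by lra.
Qed.

(** Half of 4 e is the distortion between s and x, the other half the norm of a partner of x. *)
Lemma rel_norm s y : rel s y -> `|enorm (s - x) - enorm y| <= 4 * e.
Proof.
move=> sy; have [y0 xy0] := rel_A _ A_x.
have := rel_dist _ _ _ _ sy xy0; have := rel_center_small _ xy0.
have := ler_enormD (y - y0) y0; rewrite subrK.
have := ler_enormD y (- y0); rewrite enormN.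
rewrite !ler_distl => h1 h2 h3 /andP[h4 h5]; apply/andP; split; lra.
Qed.

(** Each of the three squared norms in the polarization identity is off by at most 8 e r; the total
    24 e r is halved. *)
Lemma rel_dot s y s' y' : rel s y -> rel s' y' ->
  `|dot (s - x) (s' - x) - dot y y'| <= 12 * e * r.
Proof.
move=> sy sy'.
have [/A_norm /ltW sr /ltW yr] := relP _ _ sy.
have [/A_norm /ltW sr' /ltW yr'] := relP _ _ sy'.
have h1 : `|enorm (s - x) ^+ 2 - enorm y ^+ 2| <= 2 * r * (4 * e).
  by apply: ler_dist_sqr; rewrite ?enorm_ge0 //; exact: rel_norm.
have h2 : `|enorm (s' - x) ^+ 2 - enorm y' ^+ 2| <= 2 * r * (4 * e).
  by apply: ler_dist_sqr; rewrite ?enorm_ge0 //; exact: rel_norm.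
have h3 : `|enorm (s - x - (s' - x)) ^+ 2 - enorm (y - y') ^+ 2| <=
    2 * (2 * r) * (2 * e).
  apply: ler_dist_sqr; rewrite ?enorm_ge0 /=.
  - have := ler_enormD (s - x) (- (s' - x)); rewrite enormN; lra.
  - have := ler_enormD y (- y'); rewrite enormN; lra.
  - by rewrite opprB addrA subrK; exact: rel_dist.
move: h1 h2 h3; rewrite !sqr_enorm.
have := dot_polarization _ _ (s - x) (s' - x).
have := dot_polarization _ _ y y'.
rewrite !ler_distl => p1 p2 /andP[? ?] /andP[? ?] /andP[? ?].
apply/andP; split; lra.
Qed.

(** The error 12 e r of [rel_dot] at partners of the points (r / 2) e_i, which lie inside the open
    ball, is scaled by (2 / r)^2 between two frame vectors and by 2 / r against s - x. *)
Lemma near_isometry_frame : exists w : 'I_n -> euclidean R d,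
  (forall i j, `|dot (w i) (w j) - (i == j)%:R| <= 48 * e / r) /\
  (forall s y, rel s y -> forall i, `|dot (s - x) (w i) - y ord0 i| <= 24 * e).
Proof.
pose b i : euclidean R n := (r / 2) *: (delta_mx ord0 i : 'rV[R]_n).
have dotb y i : dot y (b i) = r / 2 * y ord0 i by rewrite dotZr dot_delta.
have rb i : exists p, rel p (b i).
  apply: rel_ball; rewrite enormZ /enorm dot_delta mxE !eqxx sqrtr1 mulr1.
  by have hr := r_gt0; rewrite ger0_norm; lra.
have [p pb] := choice rb.
have r0 : r != 0 by rewrite gt_eqF.
have r2_gt0 : 0 < 2 / r by rewrite divr_gt0.
exists (fun i => (2 / r) *: (p i - x)); split=> [i j|s y sy i].
  rewrite dotZl dotZr.
  have -> : (i == j)%:R = 2 / r * (2 / r * dot (b i) (b j)) :> R.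
    by rewrite dotb mxE mxE eqxx /= eq_sym; field.
  rewrite -!mulrBr !(normrM (2 / r)) (ger0_norm (ltW r2_gt0)).
  have -> : 48 * e / r = 2 / r * (2 / r * (12 * e * r)) by field.
  by rewrite !ler_pM2l //; exact: rel_dot.
rewrite dotZr.
have -> : y ord0 i = 2 / r * dot y (b i) by rewrite dotb; field.
rewrite -mulrBr (normrM (2 / r)) (ger0_norm (ltW r2_gt0)).
have -> : 24 * e = 2 / r * (12 * e * r) by field.
by rewrite ler_pM2l //; exact: rel_dot.
Qed.

(** The plane is x plus the span of the frame. The smallness of e gives k <= 1 / 2, which makes the
    frame free and keeps both rescalings close to the identity. *)
Lemma near_isometry_plane : (0 < n)%N -> 96 * n%:R * e <= r ->
  exists G : set (euclidean R d), [/\ affine_plane n G, G x,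
    A `<=` \bigcup_(b in G `&` ball x r) ball b (Num.sqrt (400 * n%:R * e * r)) &
    G `&` ball x r `<=` \bigcup_(a in A) ball a (Num.sqrt (400 * n%:R * e * r))].
Proof.
move=> n_gt0 ner; have hr := r_gt0; have he := e_gt0.
have r_ge0 := ltW r_gt0; have e_ge0 := ltW e_gt0.
have [w [ww sw]] := near_isometry_frame.
have n1 : 1 <= n%:R :> R by rewrite ler1n.
(* [k] is the relative error in |sum_i c_i w_i|^2 = |c|^2; points are rescaled
   by 1 / (1 + k) or 1 - k to stay inside the open balls. *)
pose K := n%:R * e * r; pose k := 48 * e / r * n%:R.
have eK : e * r <= K by rewrite /K -mulrA ler_peMl // mulr_ge0 // ltW.
have K_gt0 : 0 < K by rewrite (lt_le_trans _ eK) // mulr_gt0.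
have r0 : r != 0 by rewrite gt_eqF.
have k_ge0 : 0 <= k by rewrite mulr_ge0 // divr_ge0 ?mulr_ge0 // ltW.
have krK : k * r ^+ 2 = 48 * K by rewrite /k /K; field.
have k_half : k <= 2^-1.
  have -> : k = (48 * n%:R * e) / r by rewrite /k; field.
  by rewrite ler_pdivrMr //; lra.
have k1 : 0 < 1 + k by lra.
have k1' : 0 < 1 - k by lra.
have Tsqr c : `|enorm (lincomb w c) ^+ 2 - enorm c ^+ 2| <= k * enorm c ^+ 2.
  by rewrite !sqr_enorm; apply: sqr_enorm_lincomb_near.
(* Since 1 + k <= (1 + k)^2 and (1 - k)^2 <= 1 - k, the bounds on squares yield linear ones without
   square roots. *)
have Tup c : enorm (lincomb w c) <= (1 + k) * enorm c.
  rewrite -(@ler_pXn2r _ 2) // ?nnegrE ?mulr_ge0 ?enorm_ge0 ?(ltW k1) ?(ltW k1') //.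
  have := Tsqr c; rewrite ler_distl exprMn => /andP[_ H].
  apply: (le_trans H); rewrite -subr_ge0.
  have -> : (1 + k) ^+ 2 * enorm c ^+ 2 - (enorm c ^+ 2 + k * enorm c ^+ 2) =
    k * (1 + k) * enorm c ^+ 2 by ring.
  by apply: mulr_ge0; [apply: mulr_ge0 => //; exact: ltW | exact: sqr_ge0].
have Tlow c : (1 - k) * enorm c <= enorm (lincomb w c).
  rewrite -(@ler_pXn2r _ 2) // ?nnegrE ?mulr_ge0 ?enorm_ge0 ?(ltW k1) ?(ltW k1') //.
  have := Tsqr c; rewrite ler_distl exprMn => /andP[H _].
  apply: le_trans H; rewrite -subr_ge0.
  have -> : enorm c ^+ 2 - k * enorm c ^+ 2 - (1 - k) ^+ 2 * enorm c ^+ 2 =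
    k * (1 - k) * enorm c ^+ 2 by ring.
  by apply: mulr_ge0; [apply: mulr_ge0 => //; exact: ltW | exact: sqr_ge0].
(* The expansion costs 12 K from |s - x|^2, 48 K from |sum_i y_i w_i|^2 and twice 24 K from the
   cross term. *)
have Tnear s y : rel s y -> enorm (s - x - lincomb w y) ^+ 2 <= 108 * K.
  move=> sy; have [_ yr] := relP _ _ sy.
  have := rel_dot _ _ _ _ sy sy.
  have := dot_lincomb_near _ _ _ _ (sw _ _ sy).
  have := Tsqr y; have := dot_polarization _ _ (s - x) (lincomb w y).
  rewrite !sqr_enorm !ler_distl => p /andP[_ h1] /andP[h2 _] /andP[_ h3].
  have h4 : k * dot y y <= 48 * K.
    by rewrite -krK ler_wpM2l // -sqr_enorm ler_pXn2r ?nnegrE ?enorm_ge0 // ltW.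
  have h5 : 24 * e * (n%:R * enorm y) <= 24 * K.
    have -> : 24 * K = 24 * e * (n%:R * r) by rewrite /K; ring.
    by rewrite !ler_wpM2l // ?mulr_ge0 // ltW.
  by lra.
(* Here a is the residual of [Tnear] and b the displacement due to rescaling, with b^2 <= 24 K. Then
   (a + b)^2 <= 2 a^2 + 2 b^2 <= 264 K, strictly below 400 K as open balls require. *)
have sumlt a b : 0 <= a -> 0 <= b -> a ^+ 2 <= 108 * K -> b <= k * r ->
    a + b < Num.sqrt (400 * n%:R * e * r).
  move=> a0 b0 aK bk.
  have bK : b ^+ 2 <= 24 * K.
    have : b ^+ 2 <= (k * r) ^+ 2.
      by rewrite ler_pXn2r // nnegrE // mulr_ge0.
    have : (k * r) ^+ 2 <= 2^-1 * (48 * K).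
      have -> : (k * r) ^+ 2 = k * (k * r ^+ 2) by ring.
      by rewrite krK ler_wpM2r // mulr_ge0 // ltW.
    by lra.
  rewrite -(@ltr_pXn2r _ 2) // ?nnegrE ?addr_ge0 // sqr_sqrtr; last first.
    by rewrite !mulr_ge0 // ltW.
  have -> : 400 * n%:R * e * r = 400 * K by rewrite /K; ring.
  have := sqr_ge0 (a - b).
  by rewrite sqrrB sqrrD; lra.
pose X := [tuple w i | i < n]; pose V := <<X>>%VS.
have lincombE c : lincomb w c = \sum_(i < n) c ord0 i *: X`_i.
  by apply: eq_bigr => i _; rewrite -tnth_nth tnth_mktuple.
have lincombV c : lincomb w c \in V.
  rewrite lincombE rpred_sum // => i _; rewrite rpredZ // memv_span //.
  by rewrite mem_nth // size_tuple.
exists [set x + v | v in [set` V]]; split.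
- exists x, V; split=> //; rewrite -[RHS](size_tuple X); apply/eqP.
  (* By [Tlow], a vanishing combination has coefficient vector of norm 0, so the frame is free and
     the plane has dimension n. *)
  rewrite -/(free X); apply/freeP => a a0 i.
  pose c : euclidean R n := \row_j a j.
  have : lincomb w c = 0.
    by rewrite lincombE -[RHS]a0; apply: eq_bigr => j _; rewrite mxE.
  move=> c0; have := Tlow c; have := coord_le_enorm c i.
  rewrite c0 /enorm dot0l sqrtr0 mxE -/(enorm c) => h1 h2.
  have : enorm c <= 0 by rewrite -(@pmulr_rle0 _ (1 - k)) //; lra.
  by move=> h3; apply/eqP; rewrite -normr_le0 (le_trans h1).
- by exists 0; rewrite ?addr0 //= mem0v.
- move=> s /rel_A [y sy]; have [_ yr] := relP _ _ sy.
  pose v := (1 + k)^-1 *: lincomb w y.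
  have vr : enorm v < r.
    apply: le_lt_trans yr.
    by rewrite enormZ ger0_norm ?invr_ge0 ?(ltW k1) // mulrC ler_pdivrMr // mulrC.
  exists (x + v).
    split; first by exists v => //=; rewrite rpredZ.
    by rewrite ball_enorm /= opprD addrA subrr sub0r enormN.
  rewrite ball_enorm /= -opprB enormN.
  have -> : s - (x + v) = (s - x - lincomb w y) + k *: v.
    have -> : k *: v = lincomb w y - v.
      rewrite /v scalerA -{2}(scale1r (lincomb w y)) -scalerBl; congr (_ *: _).
      by field; rewrite gt_eqF.
    by rewrite addrA subrK opprD addrA.
  apply: le_lt_trans (ler_enormD _ _) _; apply: sumlt; rewrite ?enorm_ge0 //.
    exact: Tnear.
  by rewrite enormZ ger0_norm // ler_wpM2l // ltW.
- move=> _ [[v /= /coord_span Vv <-]].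
  rewrite ball_enorm /= opprD addrA subrr sub0r enormN => vr.
  pose c : euclidean R n := \row_i coord X i v.
  have cv : lincomb w c = v.
    by rewrite lincombE [RHS]Vv; apply: eq_bigr => i _; rewrite mxE.
  (* [Tlow] bounds the norm of (1 - k) c by |v| < r, so this point of the model ball has a
     partner. *)
  have [s sy] : exists s, rel s ((1 - k) *: c).
    apply: rel_ball; apply: le_lt_trans vr; rewrite -cv enormZ ger0_norm //.
    by lra.
  have [As _] := relP _ _ sy; exists s => //.
  rewrite ball_enorm /=.
  have -> : s - (x + v) = (s - x - lincomb w ((1 - k) *: c)) - k *: v.
    by rewrite lincombZ cv scalerBl scale1r opprB addrAC addrA subrK opprD addrA.
  apply: le_lt_trans (ler_enormD _ _) _; apply: sumlt; rewrite ?enorm_ge0 //.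
    exact: Tnear.
  by rewrite enormN enormZ ger0_norm // ler_wpM2l // ltW.
Qed.

End near_isometry.

(** * Elementary bounds on [alpha] *)

Section alpha_bounds.
Context {R : realType} {d n : nat} {S : set (euclidean R d)}.
Context {x : euclidean R d} {r : R}.
Context (S_x : S x) (r_gt0 : 0 < r).

Lemma hausdorff_dist_ge0 (X : metricType R) (A B : set X) :
  (0 <= hausdorff_dist A B)%E.
Proof.
by apply: le_ereal_inf_tmp => _ [e [e0 _] <-]; rewrite lee_fin ltW.
Qed.

Lemma alpha_ge0 : (0 <= alpha n S x r)%E.
Proof.
apply: mule_ge0; first by rewrite lee_fin invr_ge0 ltW.
by apply: le_ereal_inf_tmp => _ [G _ <-]; exact: hausdorff_dist_ge0.
Qed.

Lemma alpha_le (G : set (euclidean R d)) (e : R) :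
  affine_plane n G -> G x -> 0 < e ->
  S `&` ball x r `<=` \bigcup_(b in G `&` ball x r) ball b e ->
  G `&` ball x r `<=` \bigcup_(a in S `&` ball x r) ball a e ->
  (alpha n S x r <= (r^-1 * e)%:E)%E.
Proof.
move=> Gn Gx e0 SG GS; rewrite EFinM; apply: lee_wpmul2l.
  by rewrite lee_fin invr_ge0 ltW.
apply: (@le_trans _ _ (hausdorff_dist (S `&` ball x r) (G `&` ball x r))).
  by apply: ereal_inf_lbound; exists G.
by apply: ereal_inf_lbound; exists e.
Qed.

(** Keeps the infimum in [alpha] from being taken over an empty family, where it would be +oo. The
    direction is spanned by the first n vectors of a basis. *)
Lemma affine_plane_exists : (n <= d)%N ->
  exists2 G : set (euclidean R d), affine_plane n G & G x.
Proof.
move=> nd; pose B := vbasis {:euclidean R d}.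
have Bfree : free B by exact: basis_free (vbasisP _).
have Bsize : size B = d by rewrite size_tuple dimvf [LHS]mul1n.
have Vn : \dim <<take n B>> = n.
  have /eqP -> : free (take n B).
    by apply: (catl_free (Y := drop n B)); rewrite cat_take_drop.
  by rewrite size_takel // Bsize.
exists [set x + v | v in [set` <<take n B>>%VS]].
  by exists x, <<take n B>>%VS.
by exists 0; rewrite ?addr0 //= mem0v.
Qed.

(** Both sets contain x and lie in the open r-ball around it, so x alone serves as the nearby point
    for all others. *)
Lemma alpha_le1 : (n <= d)%N -> (alpha n S x r <= 1)%E.
Proof.
move=> /affine_plane_exists [G Gn Gx].
have x_ball : ball x r x by exact: ballxx.
rewrite (_ : 1%E = (r^-1 * r)%:E); last by rewrite mulVf ?gt_eqF.
apply: (alpha_le G) => // s [_ sr]; exists x => //; exact: ball_sym.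
Qed.

End alpha_bounds.

(** * The correspondence induced by embeddings into a common metric space *)

Section gromov_hausdorff.
Context {R : realType} {d n : nat}.
Context {A : set (euclidean R d)} {B : set (euclidean R n)}.
Context {Z : metricType R} (f : A -> Z) (g : B -> Z) (e : R).

(** Stated on ambient vectors instead of subtype elements, so that it can serve as [rel] above. *)
Definition paired (s : euclidean R d) (y : euclidean R n) : Prop :=
  exists (a : A) (b : B),
    [/\ set_val a = s, set_val b = y & mdist (f a) (g b) < e].

Lemma paired_mem s y : paired s y -> A s /\ B y.
Proof. by move=> [a [b [<- <- _]]]; split; exact: set_valP. Qed.

Lemma paired_total_l : range f `<=` \bigcup_(z in range g) ball z e ->
  forall s, A s -> exists y, paired s y.
Proof.
move=> fg s As; pose a : A := SigSub (mem_set As).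
have [_ [b _ <-]] := fg (f a) (imageT f a).
rewrite ballEmdist /= => ba; exists (set_val b), a, b; split=> //.
by rewrite metric_sym.
Qed.

Lemma paired_total_r : range g `<=` \bigcup_(z in range f) ball z e ->
  forall y, B y -> exists s, paired s y.
Proof.
move=> gf y By; pose b : B := SigSub (mem_set By).
have [_ [a _ <-]] := gf (g b) (imageT g b).
by rewrite ballEmdist /= => ab; exists (set_val a), a, b.
Qed.

(** Triangle inequalities in Z: passing from one pair of images to the other moves each endpoint by
    less than e. *)
Lemma paired_distortion : isometric f -> isometric g ->
  forall s y s' y', paired s y -> paired s' y' ->
  `|enorm (s - s') - enorm (y - y')| <= 2 * e.
Proof.
move=> fi gi _ _ _ _ [a [b [<- <- ab]]] [a' [b' [<- <- ab']]].
rewrite -!mdist_enorm.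
have -> : mdist (set_val a) (set_val a') = mdist (f a) (f a') by rewrite fi.
have -> : mdist (set_val b) (set_val b') = mdist (g b) (g b') by rewrite gi.
have := metric_triangle (f a) (g b) (f a').
have := metric_triangle (g b) (g b') (f a').
have := metric_triangle (g b) (f a) (g b').
have := metric_triangle (f a) (f a') (g b').
rewrite (metric_sym (g b) (f a)) (metric_sym (g b') (f a')) ler_distl.
by move=> h1 h2 h3 h4; apply/andP; split; lra.
Qed.

End gromov_hausdorff.

(** * Comparison of [alpha] with the Gromov-Hausdorff distance *)

Theorem proposition4p1 (R : realType) (n : nat) (hn : (1 <= n)%N) :
  exists C : R, 0 < C /\
    forall (d : nat) (S : set (euclidean R d)), (n < d)%N ->
    forall (x : euclidean R d) (r : R), S x -> 0 < r ->
      (alpha n S x r ^+ 2 <= C%:E * GH_flatness n S x r)%E.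
Proof.
have n_gt0 : 0 < n%:R :> R by rewrite ltr0n.
exists (400 * n%:R); split=> [|d S nd x r Sx r_gt0]; first by rewrite mulr_gt0.
have C_gt0 : 0 < 400 * n%:R / r by rewrite divr_gt0 ?mulr_gt0.
have A_le1 := alpha_le1 Sx r_gt0 (ltnW nd).
have A_ge0 : (0 <= alpha n S x r)%E := alpha_ge0 r_gt0.
have [a aE] : exists a, alpha n S x r = a%:E.
  exists (fine (alpha n S x r)); rewrite fineK // ge0_fin_numE //.
  by rewrite (le_lt_trans A_le1) ?ltry.
move: A_le1 A_ge0; rewrite aE !lee_fin => a_le1 a_ge0.
(* In this form the claim is a lower bound on an infimum of infima, so it suffices to treat each
   pair of embeddings and each admissible e. *)
suff GHa : ((a ^+ 2 / (400 * n%:R / r))%:E <=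
    gromov_hausdorff_dist (set_type (S `&` ball x r))
      (set_type (ball (0%R : euclidean R n) r)))%E.
  rewrite /GH_flatness muleA -EFinM -EFin_expe.
  have -> : a ^+ 2 = 400 * n%:R / r * (a ^+ 2 / (400 * n%:R / r)).
    by rewrite mulrC divfK // gt_eqF.
  by rewrite [X in (X <= _)%E]EFinM; apply: lee_wpmul2l; rewrite // lee_fin ltW.
apply: le_ereal_inf_tmp => _ [Z [f [g [fi gi ->]]]].
apply: le_ereal_inf_tmp => _ [e [e_gt0 [fg gf]] <-].
rewrite lee_fin ler_pdivrMr // -mulrA mulrC.
have -> : 400 * (n%:R / r) * e = r^-1 ^+ 2 * (400 * n%:R * e * r).
  by field; rewrite gt_eqF.
have [ner|rne] := leP (96 * n%:R * e) r.
  have ballB y : ball (0 : euclidean R n) r y = (enorm y < r).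
    by rewrite ball_enorm /= sub0r enormN.
  have A_x : (S `&` ball x r) x by split=> //; exact: ballxx.
  have [G [Gn Gx SG GS]] : exists G : set (euclidean R d),
    [/\ affine_plane n G, G x,
      S `&` ball x r `<=`
        \bigcup_(b in G `&` ball x r) ball b (Num.sqrt (400 * n%:R * e * r)) &
      G `&` ball x r `<=` \bigcup_(a in S `&` ball x r)
        ball a (Num.sqrt (400 * n%:R * e * r))].
    apply: (near_isometry_plane (rel := paired f g e)) => //.
    - exact: paired_total_l.
    - by move=> y yr; apply: paired_total_r; rewrite // ballB.
    - by move=> s y; rewrite -ballB; exact: paired_mem.
    - exact: paired_distortion.
  have K_gt0 : 0 < 400 * n%:R * e * r by rewrite !mulr_gt0.
  have := alpha_le r_gt0 _ _ Gn Gx _ SG GS.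
  rewrite sqrtr_gt0 aE lee_fin => /(_ K_gt0) ale.
  rewrite -(sqr_sqrtr (ltW K_gt0)) -exprMn ler_pXn2r // nnegrE.
  by rewrite mulr_ge0 ?sqrtr_ge0 // invr_ge0 ltW.
(* Here r < 96 n e, so 400 n e / r exceeds 1 and the trivial bound on a is enough. *)
have a2 : a ^+ 2 <= 1 by rewrite expr_le1.
apply: (le_trans a2).
have -> : r^-1 ^+ 2 * (400 * n%:R * e * r) = 400 * n%:R * e / r.
  by field; rewrite gt_eqF.
by rewrite ler_pdivlMr // mul1r; lra.
Qed.
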